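(* Let $c\geq 1$ and let $p$ be a prime with $p>c$. Every finite $c$-nilpotent group of exponent $p$ embeds in a finite UL-equivalent $c$-nilpotent group of exponent $p$.
   Context: A group is $c$-nilpotent if it is nilpotent of class at most $c$. A group has exponent $p$ if $g^p=1$ for all its elements $g$. For a group $G$, $\gamma_1(G)=G$, $\gamma_{i+1}(G)=[G,\gamma_i(G)]$ is the lower central series, and $Z_0(G)=1$, $Z_{i+1}(G)/Z_i(G)=Z(G/Z_i(G))$ is the upper central series. For the fixed $c$, a $c$-nilpotent group $G$ is UL-equivalent if $\gamma_i(G)=Z_{c+1-i}(G)$ for all $1\leq i\leq c+1$ (if $G\neq 1$ this forces $G$ to have class exactly $c$). *)

(* Defs.v *)
From mathcomp Require Import all_boot all_fingroup all_solvable.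

Set Implicit Arguments.
Unset Strict Implicit.
Unset Printing Implicit Defensive.

Local Open Scope group_scope.

Definition c_nilpotent (c : nat) (gT : finGroupType) (G : {group gT}) : Prop :=
  nilpotent G /\ nil_class G <= c.

(* "Exponent p" means that p annihilates the group: the trivial group has
   exponent p for every p, so this is not [exponent G = p]. *)
Definition has_exponent (p : nat) (gT : finGroupType) (G : {group gT}) : Prop :=
  forall g : gT, g \in G -> g ^+ p = 1.

(* 'L_i(G) is gamma_i(G) for i >= 1, and 'Z_i(G) is Z_i(G).
   The nilpotency bound is a separate hypothesis. *)
Definition UL_equivalent (c : nat) (gT : finGroupType) (G : {group gT}) : Prop :=
  forall i : nat, 1 <= i <= c.+1 -> 'L_i(G) = 'Z_(c.+1 - i)(G).

Definition embeds_in (gT rT : finGroupType) (G : {group gT}) (H : {group rT})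
    : Prop :=
  exists f : {morphism G >-> rT}, 'injm f /\ f @* G \subset H.

(* Main.v *)
From HB Require Import structures.
Require Import Defs.
From mathcomp Require Import all_boot all_fingroup all_solvable.
From mathcomp Require Import all_algebra mxabelem ring.

(** For p > c the group H of lower unitriangular matrices of size c+1 over any
    finite ring R of characteristic p is c-nilpotent, of exponent p and UL-equivalent: both the
    lower and the upper central series are given by the distance to the
    diagonal ([lcn_uni], [ucn_uni]).  It remains to embed G in such a group,
    with R a matrix ring over F_p.

    For that, let G act by translation on the functions from G to F_p.  Those
    that are killed by every product (h_1 - 1)...(h_m - 1) with h_i in the
    j_i-th term of the lower central series of G and j_1 + ... + j_m >= k form
    the space V_k of polynomial functions of degree < k, and g - 1 maps V_(k+1)
    to V_k for every g in G.  A flag of length c+1 on which G acts in this way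
    gives a morphism from G to the unitriangular group over the ring of all
    endomorphisms: splitting the flag by orthogonal idempotents e_i, one maps g
    to the matrix 1 + (e_i (g - 1) e_j) ([flag_embedding]).

    This morphism is injective as soon as the polynomial functions of degree at
    most c separate every g <> 1 from 1 ([separation]); dually, the
    (c+1)-st power of the augmentation ideal of the group algebra F_p[G]
    contains no g - 1 with g <> 1, which is a case of a theorem of Jennings.
    The group is climbed along a chain that refines the lower central series
    and has factors of order p.  As G has exponent p, each step is a semidirect
    product of a smaller term N by a group <a> of order p.  The function that
    takes n a^i to f(n) has the same degree as f ([pdeg_ext]), because
    translation by n and conjugation by a act on it through N; and the
    coordinate i of n a^i is a further polynomial function, which detects the
    elements outside N. *)

Set Implicit Arguments.
Unset Strict Implicit.
Unset Printing Implicit Defensive.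

Import GRing.Theory FinRing.Theory.
Local Open Scope group_scope.
Local Open Scope ring_scope.

(** * Unitriangular groups over a finite ring *)

Lemma mulB1 (T : pzRingType) (A B : T) :
  A * B - 1 = (A - 1) * (B - 1) + (A - 1) + (B - 1).
Proof.
rewrite -[in LHS](subrK 1 A) -[in LHS](subrK 1 B).
by rewrite mulrDl mulrDr mul1r mulr1 addrA addrK.
Qed.

Lemma comm_shift1 (T : pzRingType) (A B : T) :
  (A - 1) * (B - 1) - (B - 1) * (A - 1) = A * B - B * A.
Proof.
rewrite -[in RHS](subrK 1 A) -[in RHS](subrK 1 B).
move: (A - 1) (B - 1) => X Y.
rewrite !mulrDl !mulrDr !mul1r !mulr1 -[_ + X + (Y + 1)]addrA.
rewrite -[_ + Y + (X + 1)]addrA [X + (Y + 1)]addrCA.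
by rewrite [- (_ + (_ + _))]opprD addrACA subrr addr0.
Qed.

Lemma mul_shift1 (T : pzRingType) (F W s : T) :
  (1 + F) * W - 1 - (F + s) = (W - 1 - s) + F * (W - 1).
Proof.
rewrite mulrDl mul1r mulrBr mulr1 opprD !addrA [LHS]addrAC; congr (_ - _).
by rewrite [W + _ - 1]addrAC [LHS]addrAC.
Qed.

(** Square matrices over a ring that need not be commutative only have a ring
    structure; this copy carries the unit ring structure that exists on every
    finite ring, hence a group of units. *)
Definition sqmx (R : finNzRingType) (c : nat) : Type := 'M[R]_c.+1.
HB.instance Definition _ (R : finNzRingType) (c : nat) :=
  GRing.NzRing.on (sqmx R c).
HB.instance Definition _ (R : finNzRingType) (c : nat) :=
  Finite.on (sqmx R c).
HB.instance Definition _ (R : finNzRingType) (c : nat) :=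
  FinRing.isNzRing.Build (sqmx R c).

Section LowerTriangular.
Variables (R : finNzRingType) (c : nat).
Local Notation S := (sqmx R c).
Implicit Types (A B : S) (u v : {unit S}).

Definition low k : pred S :=
  fun A => [forall i, forall j, (A i j != 0) ==> (j + k <= i)%N].

Lemma lowP k A : reflect (forall i j, A i j != 0 -> (j + k <= i)%N) (low k A).
Proof.
by apply: (iffP forallP) => [L i j|L i]; [move/forallP: (L i) => /(_ j)/implyP
  | apply/forallP=> j; apply/implyP/L].
Qed.

Lemma low0 k : low k 0.
Proof. by apply/lowP=> i j; rewrite mxE eqxx. Qed.

Lemma lowW k l A : (k <= l)%N -> low l A -> low k A.
Proof.
move=> lekl /lowP LA; apply/lowP=> i j /LA; apply: leq_trans.
by rewrite leq_add2l.
Qed.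

Lemma lowD k A B : low k A -> low k B -> low k (A + B).
Proof.
move=> /lowP LA /lowP LB; apply/lowP=> i j; rewrite mxE.
have [-> | /LA //] := eqVneq (A i j) 0; rewrite add0r; exact: LB.
Qed.

Lemma lowN k A : low k A -> low k (- A).
Proof. by move=> /lowP LA; apply/lowP=> i j; rewrite mxE oppr_eq0 => /LA. Qed.

Lemma lowB k A B : low k A -> low k B -> low k (A - B).
Proof. by move=> LA LB; apply: lowD => //; apply: lowN. Qed.

Lemma lowM k l A B : low k A -> low l B -> low (k + l) (A * B).
Proof.
move=> /lowP LA /lowP LB; apply/lowP=> i j; rewrite mxE => nz.
have [n nzn]: exists n, A i n * B n j != 0.
  apply/existsP; apply: contraNT nz; rewrite negb_exists => /forallP Z.
  by rewrite big1 // => n _; apply/eqP; move: (Z n); rewrite negbK.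
have nA: A i n != 0 by apply: contraNneq nzn => ->; rewrite mul0r.
have nB: B n j != 0 by apply: contraNneq nzn => ->; rewrite mulr0.
apply: leq_trans (LA _ _ nA); rewrite addnC -addnA [(l + j)%N]addnC addnC.
by rewrite leq_add2r LB.
Qed.

Lemma low1 : low 0 (1 : S).
Proof.
apply/lowP=> i j; rewrite mxE addn0; case: (eqVneq i j) => [-> // | _].
by rewrite mulr0n eqxx.
Qed.

Lemma low_eq0 A : low c.+1 A -> A = 0.
Proof.
move=> /lowP LA; apply/matrixP=> i j; rewrite [RHS]mxE.
apply/eqP/negPn/negP=> /LA/(leq_trans (leq_addl _ _)).
by rewrite leqNgt ltn_ord.
Qed.

Lemma lowX A n : low 1 A -> low n (A ^+ n).
Proof.
move=> LA; elim: n => [|n IHn]; first exact: low1.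
by rewrite exprS -add1n; apply: lowM.
Qed.

Definition uni_set k := [set u : {unit S} | low k (val u - 1)].

Lemma uni_group_set k : group_set (uni_set k).
Proof.
apply/group_setP; split=> [|u v]; rewrite !inE ?subrr ?low0 // => Lu Lv.
have ->: val (u * v)%g - 1 =
    (val u - 1) * (val v - 1) + (val u - 1) + (val v - 1).
  by rewrite val_unitM mulB1.
by do 2!apply: lowD => //; apply: lowW (lowM Lu Lv); apply: leq_addr.
Qed.
Canonical uni_group k := Group (uni_group_set k).

Lemma low_uni k u : u \in uni_group k -> low 0 (val u).
Proof.
rewrite inE => Lu; rewrite -[val u](subrK 1); apply: lowD low1.
exact: lowW Lu.
Qed.

Lemma uni_group1 : uni_group c.+1 = 1%G.
Proof.
apply/val_inj/trivgP/subsetP=> u; rewrite inE => /low_eq0/eqP.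
by rewrite subr_eq0 -val_unit1 => /eqP/val_inj->; apply: set11.
Qed.

Lemma uni_groupS k l : (k <= l)%N -> uni_group l \subset uni_group k.
Proof. by move=> lekl; apply/subsetP=> u; rewrite !inE; apply: lowW. Qed.

(** The inverse is the geometric series in the nilpotent matrix - A. *)
Lemma low_unit A : low 1 A -> 1 + A \is a GRing.unit.
Proof.
move=> LA; pose s := \sum_(i < c.+1) (- A) ^+ i.
have rs: (1 + A) * s = 1.
  have ->: 1 + A = - (- A - 1) by rewrite opprB opprK.
  have nil: (- A) ^+ c.+1 = 0 by apply/low_eq0/lowX/lowN.
  by rewrite mulNr -(subrX1 (- A) c.+1) nil sub0r opprK.
apply/unitrP; exists s; split=> //; rewrite -{2}rs.
apply/commr_sym/commr_sum => i _; apply/commrX/commrN/commr_sym.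
by apply: commrD; [apply: commr1 | apply: commr_refl].
Qed.

(** [~ u, v] - 1 is the ring commutator of u - 1 and v - 1, up to the unit
    factor (v u)^-1. *)
Lemma uni_commg k l u v : (0 < k)%N -> (0 < l)%N ->
  u \in uni_group k -> v \in uni_group l -> [~ u, v]%g \in uni_group (k + l).
Proof.
move=> k0 l0 Uu Uv.
have E: val [~ u, v]%g - 1 = val ((v * u)^-1)%g *
    ((val u - 1) * (val v - 1) - (val v - 1) * (val u - 1)).
  by rewrite comm_shift1 mulrBr -!val_unitM mulVg /commg /conjg invMg !mulgA.
rewrite inE E; rewrite -[(k + l)%N]add0n; apply: lowM.
  apply: (low_uni (k := 1)); rewrite groupV.
  by apply: groupM; [move: Uv | move: Uu]; apply/subsetP/uni_groupS.
move: Uu Uv; rewrite !inE => Lu Lv; apply: lowB; first exact: lowM.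
by rewrite addnC; apply: lowM.
Qed.

Definition elem (i j : 'I_c.+1) (t : R) : S :=
  \matrix_(a, b) if (a == i) && (b == j) then t else 0.

Lemma elemE i j t a b : elem i j t a b = if (a == i) && (b == j) then t else 0.
Proof. exact: mxE. Qed.

Lemma low_elem k (i j : 'I_c.+1) t : (j + k <= i)%N -> low k (elem i j t).
Proof.
move=> le; apply/lowP=> a b; rewrite elemE.
by case: andP => [[/eqP-> /eqP->] //|]; rewrite eqxx.
Qed.

Lemma mul_elem i j k l s t :
  elem i j s * elem k l t = if j == k then elem i l (s * t) else 0.
Proof.
apply/matrixP=> a b; rewrite mxE (bigD1 j) //= big1 => [|n ne]; last first.
  by rewrite elemE (negPf ne) andbF mul0r.
rewrite addr0 !elemE eqxx andbT; case: (j == k) => /=.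
  by rewrite elemE; case: (a == i); case: (b == l); rewrite ?mulr0 ?mul0r.
by rewrite mulr0 [RHS]mxE.
Qed.

Lemma mul_elemr A i j t a b :
  (A * elem i j t) a b = if b == j then A a i * t else 0.
Proof.
rewrite mxE (bigD1 i) //= big1 => [|n ne]; last first.
  by rewrite elemE (negPf ne) mulr0.
by rewrite addr0 elemE eqxx /=; case: ifP; rewrite ?mulr0.
Qed.

Lemma mul_eleml A i j t a b :
  (elem i j t * A) a b = if a == i then t * A j b else 0.
Proof.
rewrite mxE (bigD1 j) //= big1 => [|n ne]; last first.
  by rewrite elemE (negPf ne) andbF mul0r.
by rewrite addr0 elemE eqxx andbT /=; case: ifP; rewrite ?mul0r.
Qed.

Lemma sum_sqmxE (I : finType) (F : I -> S) a b :
  (\sum_i F i) a b = \sum_i F i a b.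
Proof. exact: summxE. Qed.

Lemma sum_elem A : A = \sum_ij elem ij.1 ij.2 (A ij.1 ij.2).
Proof.
apply/matrixP=> a b; transitivity (\sum_ij elem ij.1 ij.2 (A ij.1 ij.2) a b).
  rewrite (bigD1 (a, b)) //= elemE !eqxx big1 ?addr0 // => -[i j] ne /=.
  rewrite elemE; case: andP => // -[/eqP Ea /eqP Eb].
  by rewrite Ea Eb eqxx in ne.
by symmetry; apply: sum_sqmxE.
Qed.

(** The unit 1 + A, or 1 when 1 + A is not invertible.  It is locked because
    unification would otherwise try to decide invertibility by computation. *)
Definition uni A : {unit S} := locked (insubd (1%g : {unit S}) (1 + A)).

Lemma val_uni A : low 1 A -> val (uni A) = 1 + A.
Proof. by move=> LA; rewrite /uni -lock val_insubd low_unit. Qed.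

Lemma uniM A B C : low 1 A -> low 1 B -> low 1 C ->
  1 + C = (1 + A) * (1 + B) -> uni C = (uni A * uni B)%g.
Proof. by move=> LA LB LC eC; apply: val_inj; rewrite val_unitM !val_uni. Qed.

Lemma uni_eq1 A : low 1 A -> uni A = 1%g -> A = 0.
Proof.
move=> LA /(congr1 val); rewrite val_uni // val_unit1 => /(canRL (addKr _)).
by rewrite addNr.
Qed.

Lemma uni_in k A : (0 < k)%N -> low k A -> uni A \in uni_group k.
Proof.
by move=> k0 LA; rewrite inE val_uni ?(lowW k0 LA) // [1 + A]addrC addrK.
Qed.

Lemma uni_elem_comm (i j k : 'I_c.+1) t : (k < j)%N -> (j < i)%N ->
  uni (elem i k t) = [~ uni (elem i j t), uni (elem j k 1%R)]%g.
Proof.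
move=> kj ji; have ki := ltn_trans kj ji.
apply: (mulgI (uni (elem j k 1%R) * uni (elem i j t))%g); rewrite -commgC.
apply: val_inj; rewrite !val_unitM !val_uni ?low_elem ?addn1 //.
have nki : (k == i) = false by apply/eqP=> E; rewrite E ltnn in ki.
have nji : (j == i) = false by apply/eqP=> E; rewrite E ltnn in ji.
have nkj : (k == j) = false by apply/eqP=> E; rewrite E ltnn in kj.
do !rewrite ?mulrDl ?mulrDr ?mul1r ?mulr1 ?mul_elem ?eqxx ?nki ?nji ?nkj.
rewrite ?mul0r ?addr0 ?addrA.
by rewrite [LHS]addrAC; congr (_ + _); apply: addrAC.
Qed.

Lemma low_entry k A (i j : 'I_c.+1) : low k A -> low k (elem i j (A i j)).
Proof.
move=> /lowP LA; apply/lowP=> a b; rewrite elemE.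
by case: andP => [[/eqP-> /eqP->] /LA //|]; rewrite eqxx.
Qed.

(** The map A |-> 1 + A turns sums into products, up to entries strictly
    further from the diagonal. *)
Lemma low_prod k (I : Type) (r : seq I) (F : I -> S) :
    (0 < k)%N -> (forall i, low k (F i)) ->
  low k.+1 (val (\prod_(i <- r) uni (F i))%g - 1 - \sum_(i <- r) F i).
Proof.
move=> k0 LF; have Ls s: low k (\sum_(i <- s) F i).
  by elim/big_rec: _ => [|i x _ Lx]; [apply: low0 | apply: lowD].
elim: r => [|i r IHr]; first by rewrite !big_nil subrr subr0 low0.
rewrite !big_cons val_unitM val_uni ?(lowW k0) //.
set W := val _ in IHr *; set s := \sum_(i <- r) F i in IHr *.
rewrite mul_shift1.
apply: lowD => //; apply: (@lowW _ (k + k)); first by rewrite -addn1 leq_add2l.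
apply: lowM (LF i) _; rewrite -[W - 1](subrK s); apply: lowD (Ls r).
exact: lowW IHr.
Qed.

(** The ordered product of the elementary factors of u approximates u up to
    the next term, so that descending induction on the distance to the diagonal
    applies. *)
Lemma uni_gen k (K : {group {unit S}}) : (0 < k)%N ->
    (forall (i j : 'I_c.+1) t, (j + k <= i)%N -> uni (elem i j t) \in K) ->
  uni_group k \subset K.
Proof.
have [n] := ubnP (c.+1 - k); elim: n k => // n IHn k le_n k0 genK.
apply/subsetP=> u Uu; have := Uu; rewrite inE; set A := val u - 1 => LA.
have [lt_ck | le_kc] := ltnP c k.
  move/(subsetP (uni_groupS lt_ck)): Uu; rewrite uni_group1.
  by move/set1P->; apply: group1.
pose v := (\prod_ij uni (elem ij.1 ij.2 (A ij.1 ij.2)))%g.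
have Kv: v \in K.
  apply: group_prod => -[i j] _ /=; have [-> | nz] := eqVneq (A i j) 0.
    have ->: elem i j 0 = 0 by apply/matrixP=> a b; rewrite elemE if_same mxE.
    suff ->: uni 0 = 1%g by apply: group1.
    by apply: val_inj; rewrite val_uni ?low0 // addr0.
  by apply: genK; move/lowP: LA => ->.
have Lv: low k.+1 (val v - 1 - A).
  rewrite [X in _ - X]sum_elem; apply: low_prod => // ij; exact: low_entry.
have Ukv: (v^-1 * u)%g \in uni_group k.+1.
  rewrite inE; have ->: val (v^-1 * u)%g - 1 = val v^-1%g * - (val v - 1 - A).
    rewrite opprB [- (val v - 1)]opprB addrA subrK mulrBr -!val_unitM.
    by rewrite mulVg.
  rewrite -[k.+1]add0n; apply: lowM (lowN Lv); apply: (low_uni (k := k)).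
  rewrite groupV inE -[val v - 1](subrK A); apply: lowD LA.
  exact: lowW Lv.
rewrite -(mulKVg v u) groupM // (subsetP (IHn k.+1 _ _ _)) //.
  rewrite subnS; case: (c.+1 - k)%N (subn_gt0 k c.+1) le_n.
    by rewrite ltnS le_kc.
  by move=> m _; rewrite ltnS.
by move=> i j t le; apply: genK; apply: leq_trans le; rewrite addnS.
Qed.

Local Notation H := (uni_group 1).

(** An elementary generator at distance greater than k from the diagonal is a
    commutator of one at distance at least k and one at distance 1, by
    [uni_elem_comm]. *)
Lemma lcn_uni k : (0 < k)%N -> 'L_k(H)%g = uni_group k.
Proof.
case: k => // k _; elim: k => [|k IHk]; first by rewrite lcn1.
rewrite lcnSn IHk; apply/eqP; rewrite eqEsubset; apply/andP; split.
  rewrite gen_subG; apply/subsetP=> _ /imset2P[u v Uu Uv ->].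
  by rewrite -[k.+2]addn1; apply: uni_commg.
apply: uni_gen => // i j t le.
have jc: (j + 1 < c.+1)%N.
  by apply: leq_ltn_trans (ltn_ord i); apply: leq_trans le; rewrite leq_add2l.
pose b := Ordinal jc.
have lt_jb : (j < b)%N by rewrite /= addn1.
have lt_bi : (b < i)%N.
  by apply: leq_trans le; rewrite /= -addnS leq_add2l.
rewrite (uni_elem_comm _ lt_jb lt_bi) mem_commg //; apply: uni_in => //.
  by apply: low_elem; rewrite /= -addnA add1n.
exact: low_elem.
Qed.

(** The ring commutator of u - 1 with an elementary matrix supported just below
    the diagonal moves an entry of u - 1 one step away from the diagonal, where
    its distance is at least k+1.  Only the bottom left corner cannot be moved,
    and its distance to the diagonal is c. *)
Lemma uni_center_step k u : (k <= c)%N -> u \in H ->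
  (forall v, v \in H -> [~ u, v]%g \in uni_group k.+1) -> u \in uni_group k.
Proof.
move=> le_kc Hu cuv; rewrite inE; set A := val u - 1.
have LA: low 1 A by move: Hu; rewrite inE.
have key (a b : 'I_c.+1) : (b < a)%N ->
      low k.+1 (A * elem a b 1 - elem a b 1 * A).
  move=> lt_ba; have LE : low 1 (elem a b 1) by apply: low_elem; rewrite addn1.
  pose v := uni (elem a b 1); have Hv: v \in H by apply: uni_in.
  have ->: elem a b 1 = val v - 1 by rewrite val_uni // [1 + _]addrC addrK.
  have ->: (val u - 1) * (val v - 1) - (val v - 1) * (val u - 1)
      = val (v * u)%g * (val [~ u, v]%g - 1).
    by rewrite comm_shift1 mulrBr mulr1 -!val_unitM -commgC.
  rewrite -[k.+1]add0n; apply: lowM.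
    by apply: (low_uni (k := 1)); rewrite groupM.
  by move: (cuv v Hv); rewrite inE.
apply/lowP=> i j nz.
have ltji: (j < i)%N by move/lowP: LA => /(_ _ _ nz); rewrite addn1.
have [j0 | j_gt0] := posnP j.
  have [ic | ic] := ltnP i c.
    (* in the first column the entry moves one row down *)
    have ic1 : (i.+1 < c.+1)%N by [].
    have := key (Ordinal ic1) i; move=> /(_ (ltnSn i))/lowP.
    move=> /(_ (Ordinal ic1) j); rewrite mxE [X in _ + X]mxE.
    rewrite mul_elemr mul_eleml eqxx mul1r.
    have ->: j == i = false by apply/eqP=> E; rewrite E ltnn in ltji.
    by rewrite add0r oppr_eq0 /= addnS ltnS; apply.
  by rewrite j0 add0n (leq_trans le_kc).
(* in any other column the entry moves one column to the left *)
have jc : (j.-1 < c.+1)%N by apply: leq_ltn_trans (leq_pred _) (ltn_ord j).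
have := key j (Ordinal jc); rewrite /= prednK // => /(_ (leqnn _))/lowP.
move=> /(_ i (Ordinal jc)); rewrite mxE [X in _ + X]mxE.
rewrite mul_elemr mul_eleml eqxx mulr1.
have ->: i == j = false by apply/eqP=> E; rewrite E ltnn in ltji.
by rewrite subr0 /= addnS -addSn prednK //; apply.
Qed.

Lemma ucn_uni j : (j <= c)%N -> 'Z_j(H)%g = uni_group (c.+1 - j).
Proof.
elim: j => [_|j IHj lt_jc]; first by rewrite ucn0 subn0 uni_group1.
have e: (c.+1 - j = (c - j).+1)%N by rewrite subSn // ltnW.
rewrite ucnSnR (IHj (ltnW lt_jc)) subSS e; apply/setP=> u; rewrite inE.
apply/andP/idP=> [[Hu cu] | Uu].
  apply: uni_center_step (leq_subr _ _) Hu _ => v Hv.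
  by apply: (subsetP cu); rewrite mem_commg // set11.
have k0: (0 < c - j)%N by rewrite subn_gt0.
split; first by apply: (subsetP (uni_groupS k0)).
rewrite gen_subG; apply/subsetP=> _ /imset2P[_ v /set1P-> Uv ->].
by rewrite -[(c - j).+1]addn1; apply: uni_commg.
Qed.

Lemma uni_UL : UL_equivalent c H.
Proof.
move=> i /andP[i0 ile]; rewrite lcn_uni // ucn_uni ?subKn //.
by rewrite leq_subLR -add1n leq_add2r.
Qed.

Lemma uni_c_nilpotent : c_nilpotent c H.
Proof.
have E: 'L_c.+1(H)%g = 1%g by rewrite lcn_uni // uni_group1.
have nilH: nilpotent H by apply/lcnP; exists c.
by split=> //; apply/(lcn_nil_classP c nilH).
Qed.

(** In characteristic p the Frobenius identity gives (1 + A)^p = 1 + A^p, and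
    A^p = 0 because p > c. *)
Lemma uni_exponent p : p \in [pchar R] -> (c < p)%N -> has_exponent p H.
Proof.
move=> charRp lt_cp u; rewrite inE => Lu; apply: val_inj.
have charSp: p \in [pchar S].
  rewrite inE (pcharf_prime charRp) /=; apply/eqP/matrixP=> i j.
  transitivity ((1 : 'M[R]_c.+1) i j *+ p); first exact: mulmxnE.
  by rewrite mxE (mulrn_pchar charRp) mxE.
rewrite val_unitX -[val u](subrK 1) -(pFrobenius_autE charSp).
rewrite pFrobenius_autD_comm; last exact: commr1.
rewrite pFrobenius_aut1 pFrobenius_autE.
by rewrite (low_eq0 (lowW lt_cp (lowX _ Lu))) add0r.
Qed.
End LowerTriangular.

(** * Polynomial functions on a nilpotent group *)

(** Induction on j by the three subgroups lemma, applied modulo the term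
    of index i + j. *)
Lemma lcn_commg (gT : finGroupType) (G : {group gT}) i j :
  (0 < i)%N -> (0 < j)%N -> [~: 'L_i(G), 'L_j(G)]%g \subset 'L_(i + j)(G).
Proof.
case: j => // j i0 _; elim: j i i0 => [|j IHj] [] // i _.
  by rewrite lcn1 addn1 -lcnSn.
have e : (i.+1 + j.+2 = (i.+1 + j.+1).+1)%N by rewrite addnS.
set M := 'L_(i.+1 + j.+2)(G).
have nM : G \subset 'N(M) by apply: lcn_norm.
have nML k : 'L_k(G) \subset 'N(M) := subset_trans (lcn_sub k G) nM.
have quo1 (A B C : {set gT}) :
    A \subset 'N(M) -> B \subset 'N(M) -> C \subset 'N(M) ->
    [~: A, B, C]%g \subset M -> [~: A / M, B / M, C / M]%g = 1%g.
  by move=> nA nB nC /quotientS1; rewrite !quotientR ?comm_subG.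
have nLG : [~: 'L_j.+1(G), G] \subset 'N(M) by apply: comm_subG.
rewrite commGC lcnSn -quotient_sub1; last exact: comm_subG.
rewrite quotientR // quotientR //.
apply/trivgP; apply: three_subgroup.
  apply: (quo1 G 'L_i.+1(G) 'L_j.+1(G)) => //.
  rewrite (commGC G) -lcnSn.
  by apply: subset_trans (IHj i.+2 isT) _; rewrite addSnnS.
apply: (quo1 'L_i.+1(G) 'L_j.+1(G) G) => //.
by rewrite /M e lcnSn commSg // IHj.
Qed.

Lemma ltn_sub_pred n k j : (0 < j)%N -> (k.+1 < n.+1)%N -> (k.+1 - j < n)%N.
Proof.
by case: j => // j _; rewrite subSS ltnS; apply: leq_ltn_trans (leq_subr _ _).
Qed.

Section PolynomialFunctions.
Variables (gT : finGroupType) (G : {group gT}) (F : fieldType).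
Implicit Types (N : {group gT}) (f : gT -> F) (g h x : gT) (k l j w : nat).

(** The action on f of the element h - 1 of the group algebra, when h acts by
    left translation of the argument. *)
Definition dif h f : gT -> F := fun x => f (h * x)%g - f x.

(** On N, the function f is polynomial of degree < k for the filtration of N
    by its intersections with the lower central series of G: a difference along
    an element of the j-th term lowers the degree by j.  Only the values of f on
    N matter.  The indices j > k are covered by j = k, see [pdegSP]. *)
Fixpoint pdeg (N : {set gT}) k (f : gT -> F) {struct k} : bool :=
  if k is k'.+1 then
    [forall i : 'I_k'.+1, forall h in N :&: 'L_i.+1(G),
       pdeg N (k' - i) (dif h f)]
  else [forall x in N, f x == 0].

Lemma pdeg0P N f : reflect {in N, forall x, f x = 0} (pdeg N 0 f).
Proof. by apply: (iffP forall_inP) => Z x /Z /eqP. Qed.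

Lemma pdegSP N k f :
  reflect (forall j h, (0 < j)%N -> h \in N -> h \in 'L_j(G) ->
             pdeg N (k.+1 - j) (dif h f))
          (pdeg N k.+1 f).
Proof.
apply: (iffP forallP) => [D j h j0 Nh Lh | D i]; last first.
  apply/forall_inP=> h /setIP[Nh Lh].
  by have := D i.+1 h isT Nh Lh; rewrite subSS.
have [ltjk | ltkj] := ltnP j.-1 k.+1.
  have /forall_inP/(_ h) := D (Ordinal ltjk).
  by rewrite /= prednK // inE Nh -subSS prednK //; apply.
have /forall_inP/(_ h) := D ord_max; rewrite /= inE Nh subnn.
have -> : (k.+1 - j = 0)%N.
  by apply/eqP; rewrite subn_eq0 (leq_trans ltkj) ?leq_pred.
apply; apply: subsetP Lh; apply: lcn_sub_leq.
by apply: leq_trans ltkj (leq_pred j).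
Qed.

Lemma pdegI N k f : (0 < k)%N ->
    (forall j h, (0 < j)%N -> h \in N -> h \in 'L_j(G) ->
       pdeg N (k - j) (dif h f)) ->
  pdeg N k f.
Proof. by case: k => // k _ /pdegSP. Qed.

Lemma pdeg_dif N k f j h : (0 < j)%N -> h \in N -> h \in 'L_j(G) ->
  pdeg N k f -> pdeg N (k - j) (dif h f).
Proof.
move=> j0 Nh Lh; case: k => [/pdeg0P Z | k /pdegSP D]; last exact: D.
by apply/pdeg0P=> x Nx; rewrite /dif !Z ?groupM // subrr.
Qed.

Lemma eq_pdeg N k f1 f2 : {in N, f1 =1 f2} -> pdeg N k f1 -> pdeg N k f2.
Proof.
have [n] := ubnP k; elim: n k f1 f2 => // n IHn [|k] f1 f2 le_kn eqf.
  by move=> /pdeg0P Z; apply/pdeg0P=> x Nx; rewrite -eqf ?Z.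
move=> Df; apply: pdegI => // j h j0 Nh Lh.
apply: (IHn _ (dif h f1)); first exact: ltn_sub_pred.
  by move=> x Nx; rewrite /dif !eqf ?groupM.
exact: pdeg_dif.
Qed.

Lemma pdeg_eq0 N k f : {in N, forall x, f x = 0} -> pdeg N k f.
Proof.
have [n] := ubnP k; elim: n k f => // n IHn [|k] f le_kn Z; first exact/pdeg0P.
apply: pdegI => // j h j0 Nh Lh; apply: IHn => [|x Nx].
  exact: ltn_sub_pred.
by rewrite /dif !Z ?groupM ?subrr.
Qed.

Lemma pdegW N k l f : (k <= l)%N -> pdeg N k f -> pdeg N l f.
Proof.
have [n] := ubnP l; elim: n k l f => // n IHn [|k] l f le_ln le_kl.
  by move/pdeg0P; apply: pdeg_eq0.
case: l le_ln le_kl => // l le_ln le_kl Df.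
apply: pdegI => // j h j0 Nh Lh.
apply: IHn (leq_sub2r j le_kl) (pdeg_dif j0 Nh Lh Df).
exact: ltn_sub_pred.
Qed.

Lemma pdeg_lin N k a f1 f2 :
  pdeg N k f1 -> pdeg N k f2 -> pdeg N k (fun x => a * f1 x + f2 x).
Proof.
have [n] := ubnP k; elim: n k f1 f2 => // n IHn [|k] f1 f2 le_kn.
  move=> /pdeg0P Z1 /pdeg0P Z2; apply/pdeg0P=> x Nx.
  by rewrite Z1 ?Z2 // mulr0 addr0.
move=> D1 D2; apply: pdegI => // j h j0 Nh Lh.
apply: (@eq_pdeg _ _ (fun x => a * dif h f1 x + dif h f2 x)) => [x Nx|].
  by rewrite /dif mulrBr opprD !addrA; congr (_ - _); rewrite addrAC.
apply: IHn; try exact: pdeg_dif.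
exact: ltn_sub_pred.
Qed.

Lemma pdegD N k f1 f2 :
  pdeg N k f1 -> pdeg N k f2 -> pdeg N k (fun x => f1 x + f2 x).
Proof.
move=> D1 D2; apply: eq_pdeg (pdeg_lin 1 D1 D2) => x _.
by rewrite mul1r.
Qed.

Lemma pdeg_const N f a : {in N, forall x, f x = a} -> pdeg N 1 f.
Proof.
move=> cf; apply: pdegI => // j h j0 Nh Lh; apply: pdeg_eq0 => x Nx.
by rewrite /dif !cf ?groupM ?subrr.
Qed.

Lemma pdeg_shift N k f h : N \subset G -> h \in N ->
  pdeg N k f -> pdeg N k (fun x => f (h * x)%g).
Proof.
move=> sNG Nh Df; apply: (@eq_pdeg _ _ (fun x => dif h f x + f x)) => [x _|].
  by rewrite /dif subrK.
apply: pdegD => //; apply: pdegW (leq_subr 1 k) _; apply: pdeg_dif => //.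
by rewrite lcn1 (subsetP sNG).
Qed.

Lemma pdeg_conj N k f g : G \subset 'N(N) -> g \in G ->
  pdeg N k f -> pdeg N k (fun x => f (x ^ g)%g).
Proof.
move=> nNG Gg; have nNg := subsetP nNG g Gg.
have [n] := ubnP k; elim: n k f => // n IHn [|k] f le_kn.
  by move/pdeg0P=> Z; apply/pdeg0P=> x Nx; rewrite Z ?memJ_norm.
move=> Df; apply: pdegI => // j h j0 Nh Lh.
apply: (@eq_pdeg _ _ (fun x => dif (h ^ g)%g f (x ^ g)%g)) => [x _|].
  by rewrite /dif conjMg.
apply: IHn; last first.
  by apply: pdeg_dif; rewrite ?memJ_norm // (subsetP (lcn_norm _ _)).
exact: ltn_sub_pred.
Qed.

(** The difference of f(x ^ g) - f(x) along h splits as the same expression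
    for the difference of f along h ^ g, plus a difference along [~ h, g] of a
    translate of f; the latter commutator lies in the term of index j + w. *)
Lemma pdeg_conjB N w k f g : N <| G -> (0 < w)%N -> g \in 'L_w(G) ->
  pdeg N k f -> pdeg N (k - w) (fun x => f (x ^ g)%g - f x).
Proof.
case/andP=> sNG nNG w0 Lg; have Gg := subsetP (lcn_sub w G) g Lg.
have nNg := subsetP nNG g Gg.
have [n] := ubnP k; elim: n k f => // n IHn [|k] f le_kn Df.
  move/pdeg0P: Df => Z; apply/pdeg0P=> x Nx.
  by rewrite !Z ?memJ_norm // subrr.
set f' := fun x => _.
have D j h : (0 < j)%N -> h \in N -> h \in 'L_j(G) ->
    pdeg N (k.+1 - w - j) (dif h f').
  move=> j0 Nh Lh; have Nhg : (h ^ g)%g \in N by rewrite memJ_norm.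
  have Lhg: (h ^ g)%g \in 'L_j(G).
    by rewrite memJ_norm // (subsetP (lcn_norm _ _)).
  have Nu : [~ h, g]%g \in N by rewrite commgEl groupM ?groupV.
  have Lu : [~ h, g]%g \in 'L_(j + w)(G).
    by apply: (subsetP (lcn_commg _ _ _)) => //; apply: mem_commg.
  have D1 := IHn (k.+1 - j)%N _ _ (pdeg_dif j0 Nhg Lhg Df).
  have D2 := pdeg_dif (ltn_addr _ j0) Nu Lu (pdeg_shift sNG Nh Df).
  apply: (@eq_pdeg _ _ (fun x => (dif (h ^ g)%g f (x ^ g)%g - dif (h ^ g)%g f x)
      + dif [~ h, g]%g (fun x => f (h * x)%g) x)) => [x Nx|].
    by rewrite /dif /f' conjMg [(h * (_ * x))%g]mulgA -conjg_mulR; ring.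
  apply: pdegD; first by rewrite subnAC; apply: D1; apply: ltn_sub_pred.
  by rewrite -subnDA addnC.
have [kw0 | kw] := posnP (k.+1 - w)%N; last exact: pdegI.
(* the function is constant on N, and it vanishes at 1 *)
rewrite kw0; apply/pdeg0P=> x Nx.
have /pdeg0P/(_ 1%g (group1 N)) : pdeg N 0 (dif x f').
  by have := D 1%N x isT Nx; rewrite lcn1 kw0 => /(_ (subsetP sNG x Nx)).
by rewrite /dif mulg1 /f' conj1g subrr subr0.
Qed.

(** All the differences of an additive function are constant. *)
Lemma pdeg_additive N w (chi : gT -> F) :
    {in N &, forall h x, chi (h * x)%g = chi h + chi x} ->
    {in N :&: 'L_w.+1(G), forall h, chi h = 0} ->
  pdeg N w.+1 chi.
Proof.
move=> chiM chi0; apply: pdegI => // j h j0 Nh Lh.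
have dchi x : x \in N -> dif h chi x = chi h.
  by move=> Nx; rewrite /dif chiM // addrK.
have [le_jw | lt_wj] := leqP j w.
  by apply: pdegW (pdeg_const dchi); rewrite subn_gt0 ltnS.
apply: pdeg_eq0 => x Nx; rewrite dchi // chi0 // inE Nh.
exact: subsetP (lcn_sub_leq _ lt_wj) h Lh.
Qed.

Section SemidirectExtension.
Variables (N M : {group gT}) (a : gT) (w : nat).
Hypotheses (w_gt0 : (0 < w)%N) (nsNG : N <| G).
Hypotheses (tiNa : N :&: <[a]> = 1%g) (defM : (N * <[a]> = M)%g).
Hypotheses (sML : M \subset 'L_w(G)) (sLN : 'L_w.+1(G) \subset N).

(** The function n * a ^ i |-> f n on the semidirect product of N by <a>. *)
Definition ext f : gT -> F := fun x => f (divgr N <[a]> x).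

(** Translation by m b, with m in N and b in <a>, acts on the extensions of
    functions on N as conjugation by b^-1 followed by translation by m ^ b.
    The conjugation changes f by a function whose degree is lower by w
    ([pdeg_conjB]), which is enough when m b lies in a term of index at most w;
    the later terms are contained in N, where b = 1. *)
Lemma pdeg_ext k f : pdeg N k f -> pdeg M k (ext f).
Proof.
have sNM: N \subset M by rewrite -defM mulG_subl.
have saM: <[a]> \subset M by rewrite -defM mulG_subr.
have [sNG nNG] := andP nsNG.
have Nd x : x \in M -> divgr N <[a]> x \in N by rewrite -defM; apply: mem_divgr.
have ar x : x \in M -> remgr N <[a]> x \in <[a]>.
  by rewrite -defM; apply: mem_remgr.
have [n] := ubnP k; elim: n k f => // n IHn [|k] f le_kn Df.
  by apply/pdeg0P=> x Mx; move/pdeg0P: Df => Z; rewrite /ext Z ?Nd.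
apply: pdegI => // j h j0 Mh Lh.
set m := divgr N <[a]> h; set b := remgr N <[a]> h.
have Nm : m \in N by apply: Nd.
have ab : b \in <[a]> by apply: ar.
have Lb : b \in 'L_w(G) by apply/(subsetP sML)/(subsetP saM).
have Gb : b \in G := subsetP (lcn_sub w G) b Lb.
pose phi x := f (x ^ b^-1)%g.
pose f1 x := dif (m ^ b)%g phi x + (phi x - f x).
apply: (@eq_pdeg _ _ (ext f1)) => [x Mx|].
  rewrite /f1 /ext /dif /phi conjMg conjgK; set y := divgr _ _ x.
  have -> : (h * x = (m * y ^ b^-1) * (b * remgr N <[a]> x))%g.
    have mulJ (s t u v : gT) : ((s * t) * (u * v) = (s * u ^ t^-1) * (t * v))%g.
      by rewrite conjgE invgK !mulgA mulgKV.
    by rewrite -mulJ -!divgr_eq.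
  have Ny : (y ^ b^-1)%g \in N.
    by rewrite memJ_norm ?Nd // groupV (subsetP nNG).
  rewrite divgrMid ?(groupM Nm) ?(groupM ab) ?ar //.
  by rewrite addrA subrK.
apply: IHn; first exact: ltn_sub_pred.
have [le_jw | lt_wj] := leqP j w; last first.
  have Nh : h \in N by apply/(subsetP sLN)/(subsetP (lcn_sub_leq _ lt_wj)).
  have b1 : b = 1%g by rewrite /b remgr1.
  have mh : m = h by rewrite /m divgr_id.
  apply: eq_pdeg (pdeg_dif j0 Nh Lh Df) => x Nx.
  by rewrite /f1 /phi /dif b1 mh invg1 !conjg1 subrr addr0.
have Lm : m \in 'L_j(G).
  by apply/(subsetP (lcn_sub_leq _ le_jw))/(subsetP sML)/(subsetP sNM).
have Dphi : pdeg N k.+1 phi by apply: pdeg_conj; rewrite ?groupV.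
apply: pdegD.
  apply: pdeg_dif => //; rewrite memJ_norm ?(subsetP nNG) //.
  exact: subsetP (lcn_norm _ _) b Gb.
apply: pdegW (leq_sub2l _ le_jw) _; apply: pdeg_conjB => //.
by rewrite groupV.
Qed.
End SemidirectExtension.
End PolynomialFunctions.

Section Separation.
Variables (c p : nat) (gT : finGroupType) (G : {group gT}).
Hypotheses (p_pr : prime p) (expG : has_exponent p G).
Hypothesis LG1 : 'L_c.+1(G) = 1%g.

(** Elements of N are separated by extended functions; the others by a
    coordinate on the factor M / N, of order p, read off the complement <a>. *)
Lemma separation_step (N M : {group gT}) w h :
    (0 < w)%N -> (w <= c)%N -> maximal N M ->
    M \subset 'L_w(G) -> 'L_w.+1(G) \subset N ->
    (forall y, y \in N -> y != 1%g ->
       exists2 f : gT -> 'F_p, pdeg G N c.+1 f & f y != f 1%g) ->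
    h \in M -> h != 1%g ->
  exists2 f : gT -> 'F_p, pdeg G M c.+1 f & f h != f 1%g.
Proof.
move=> w0 lewc maxN sML sLN sepN Mh nt_h.
have sMG : M \subset G := subset_trans sML (lcn_sub w G).
have pM : p.-group M.
  rewrite -pnat_exponent; apply: (@pnat_dvd _ p); last by rewrite pnat_id.
  by apply/exponentP=> x Mx; apply/expG/(subsetP sMG).
have nsNM := p_maximal_normal pM maxN; have iNM := p_maximal_index pM maxN.
have [sNM nNM] := andP nsNM.
have sNG : N \subset G := subset_trans sNM sMG.
have nsNG : N <| G.
  rewrite /normal sNG; apply/subsetP=> x Gx; rewrite inE.
  apply/subsetP=> _ /imsetP[y Ny ->].
  rewrite conjg_mulR groupM // (subsetP sLN) // (subsetP (lcnSnS w G)) //.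
  by rewrite mem_commg // (subsetP sML) // (subsetP sNM).
have [a Ma nNa] : exists2 a, a \in M & a \notin N.
  by apply/subsetPn; case/andP: (maxgroupp maxN).
have oa : #[a] = p.
  apply/prime_nt_dvdP; rewrite ?order_eq1 //; last first.
    by rewrite order_dvdn expG // (subsetP sMG).
  by apply: contraNneq nNa => ->; apply: group1.
have tiNa : N :&: <[a]> = 1%g.
  by rewrite setIC prime_TIg -?orderE ?oa // cycle_subG.
have defM : (N * <[a]> = M)%g.
  apply/eqP; rewrite eqEcard mul_subG ?cycle_subG //=.
  by rewrite TI_cardMg // -orderE oa -iNM Lagrange.
have [Nh | nNh] := boolP (h \in N).
  have [f Df nf] := sepN h Nh nt_h.
  exists (ext N a f); last by rewrite /ext !divgr_id.
  exact: (pdeg_ext w0).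
have abelA : p.-abelem <[a]> by rewrite prime_abelem // -orderE.
have ntA : <[a]>%G :!=: 1%g by rewrite -cardG_gt1 -orderE oa prime_gt1.
have compl : <[a]>%G \in [complements to N in M] by apply/complP.
have ar x : x \in M -> remgr N <[a]> x \in <[a]>.
  by rewrite -defM; apply: mem_remgr.
have nz : abelem_rV abelA ntA (remgr N <[a]> h) != 0.
  apply: contraNneq nNh => /(congr1 (rVabelem abelA ntA)).
  rewrite abelem_rV_K ?ar // rVabelem0 => r1.
  rewrite (divgr_eq N <[a]> h) r1 mulg1.
  by apply: mem_divgr; rewrite defM.
have [i nzi] : exists i, abelem_rV abelA ntA (remgr N <[a]> h) 0 i != 0.
  by apply/rV0Pn.
exists (fun x => abelem_rV abelA ntA (remgr N <[a]> x) 0 i); last first.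
  by rewrite (remgr1 _ (group1 N)) abelem_rV_1 mxE.
apply: (@pdegW _ _ _ _ w.+1) => //.
apply: pdeg_additive => [x y Mx My | x /setIP[Mx Lx]].
  by rewrite (remgrM compl) // abelem_rV_M ?ar // mxE.
by rewrite remgr1 ?(subsetP sLN) // abelem_rV_1 mxE.
Qed.

(** Descent along maximal subgroups.  A subgroup between two consecutive
    terms of the lower central series is normal in G; when it reaches the lower
    one, w increases. *)
Lemma separation (M : {group gT}) w h :
    (0 < w)%N -> M \subset 'L_w(G) -> 'L_w.+1(G) \subset M ->
    h \in M -> h != 1%g ->
  exists2 f : gT -> 'F_p, pdeg G M c.+1 f & f h != f 1%g.
Proof.
have [n] := ubnP (#|M| + (c.+1 - w))%N.
elim: n M w h => // n IHn M w h le_n w0 sML sLM Mh nt_h.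
have [lt_cw | le_wc] := ltnP c w.
  have sM1 : M \subset 'L_c.+1(G).
    exact: subset_trans sML (lcn_sub_leq _ lt_cw).
  by move: Mh nt_h => /(subsetP sM1); rewrite LG1 => /set1P->; rewrite eqxx.
have [eqM | [N maxN sLN]] := maximal_exists sLM.
  have sML' : M \subset 'L_w.+1(G) by rewrite eqM.
  have sLM' : 'L_w.+2(G) \subset M by rewrite -eqM lcn_subS.
  apply: IHn sML' sLM' Mh nt_h => //.
  by rewrite -ltnS; apply: leq_trans le_n; rewrite ltnS ltn_add2l ltn_sub2l.
apply: (separation_step w0 le_wc maxN) => // y Ny nt_y.
have ltNM := maxgroupp maxN.
have sNL : N \subset 'L_w(G) by apply: subset_trans (proper_sub ltNM) sML.
apply: IHn w0 sNL sLN Ny nt_y.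
by rewrite -ltnS; apply: leq_trans le_n; rewrite ltnS ltn_add2r proper_card.
Qed.
End Separation.

(** * From a flag to a unitriangular group *)

Section Flags.
Variables (K : fieldType) (d : nat) (V : nat -> 'M[K]_d).
Hypothesis V_S : forall k, (V k <= V k.+1)%MS.

Lemma flag_sub j k : (j <= k)%N -> (V j <= V k)%MS.
Proof.
move/subnK <-; elim: (k - j)%N => // n IHn.
exact: submx_trans IHn (V_S _).
Qed.

(** Nested projections q_k onto the terms of a flag.  Composing the previous
    projections with any projection onto a new top term keeps them nested. *)
Lemma flag_projections m : exists q : nat -> 'M[K]_d,
  [/\ forall k n (u : 'M_(n, d)), (k <= m)%N -> (u <= V k)%MS -> u *m q k = u,
      forall k, (k <= m)%N -> (q k <= V k)%MS
    & forall j k, (j <= k <= m)%N -> q k *m q j = q j].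
Proof.
elim: m => [|m [q [qid qV qM]]].
  exists (fun _ => pinvmx (V 0) *m V 0); split.
  - by move=> k n u; rewrite leqn0 => /eqP-> uV; rewrite mulmxA mulmxKpV.
  - by move=> k; rewrite leqn0 => /eqP->; apply: submxMl.
  - by move=> j k _; rewrite -mulmxA; congr (_ *m _); rewrite mulmxA mulmxKpV.
pose r := pinvmx (V m.+1) *m V m.+1.
have rid n (u : 'M_(n, d)) : (u <= V m.+1)%MS -> u *m r = u.
  by move=> uV; rewrite /r mulmxA mulmxKpV.
have rV : (r <= V m.+1)%MS by apply: submxMl.
clearbody r; exists (fun k => if (k <= m)%N then r *m q k else r); split.
- move=> k n u le_k uV; case: leqP => [le_km | lt_mk].
    by rewrite mulmxA rid ?qid // (submx_trans uV) // flag_sub.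
  by apply: rid; rewrite (submx_trans uV) // flag_sub.
- move=> k le_k; case: leqP => [le_km | lt_mk]; first exact: mulmx_sub (qV _ _).
  by apply: submx_trans rV (flag_sub _).
- move=> j k /andP[le_jk le_k]; case: (leqP k m) => [le_km | lt_mk].
    have le_jm := leq_trans le_jk le_km.
    rewrite le_jm -mulmxA [q k *m _]mulmxA rid ?qM ?le_jk //.
    by apply: submx_trans (qV _ le_km) (flag_sub _); apply: leqW.
  by case: (leqP j m) => _; rewrite ?mulmxA (rid _ r rV).
Qed.
End Flags.

Section FlagEmbedding.
Variables (K : finFieldType) (d c : nat) (gT : finGroupType) (G : {group gT}).
Variables (V : nat -> 'M[K]_d.+1) (rho : gT -> 'M[K]_d.+1).
Hypotheses (V_S : forall k, (V k <= V k.+1)%MS) (V_0 : V 0 = 0).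
Hypothesis rhoM : {in G &, {morph rho : x y / (x * y)%g >-> x *m y}}.
Hypothesis rhoV : forall g k, g \in G -> (V k.+1 *m (rho g - 1%:M) <= V k)%MS.
Hypothesis rho_faithful : forall g, g \in G ->
  V c.+1 *m (rho g - 1%:M) = 0 -> g = 1%g.

(** The matrix (e_i (rho g - 1) e_j) is strictly lower triangular since
    rho g - 1 lowers the flag, and it depends multiplicatively on rho g - 1
    since the idempotents e_i add up to the identity on the top of the flag. *)
Lemma flag_embedding : embeds_in G (uni_group 'M[K]_d.+1 c 1).
Proof.
have [q [qid qV qM]] := flag_projections V_S c.+1.
have q0 : q 0 = 0 by apply/eqP; rewrite -submx0 -V_0 qV.
pose e k := q k.+1 - q k.
have eV k : (k < c.+1)%N -> (e k <= V k.+1)%MS.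
  move=> ltk; rewrite addmx_sub ?qV // eqmx_opp.
  by apply: submx_trans (V_S k); rewrite qV // ltnW.
have eK k n (u : 'M_(n, _)) : (k < c.+1)%N -> (u <= V k)%MS -> u *m e k = 0.
  move=> ltk uV; rewrite mulmxBr !qid ?subrr // ?(ltnW ltk) //.
  exact: submx_trans uV (V_S k).
have ee k : (k < c.+1)%N -> e k *m e k = e k.
  move=> ltk; have eq1 : e k *m q k.+1 = e k by apply: qid (eV k ltk).
  have eq0 : e k *m q k = 0.
    by rewrite mulmxBl !qM ?leqnn ?leqnSn ?subrr // ltnW.
  by rewrite {2}/e mulmxBr eq1 eq0 subr0.
have sum_e : \sum_(k < c.+1) e k = q c.+1.
  by rewrite -(big_mkord xpredT e) telescope_sumr // q0 subr0.
clearbody e; pose dr g := rho g - 1%:M.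
have edr i g : g \in G -> (i < c.+1)%N -> (e i *m dr g <= V i)%MS.
  by move=> Gg lti; apply: submx_trans (submxMr _ (eV _ lti)) (rhoV _ Gg).
pose T g : sqmx 'M[K]_d.+1 c := \matrix_(i, j) (e i *m dr g *m e j).
have TE g i j : T g i j = e i *m dr g *m e j by rewrite mxE.
have lowT g : g \in G -> low 1 (T g).
  move=> Gg; apply/lowP=> i j; rewrite TE addn1; apply: contraR.
  rewrite -leqNgt => le_ij; apply/eqP/eK => //.
  by apply: submx_trans (edr _ _ Gg _) (flag_sub V_S _).
have TM : {in G &, {morph (fun g => 1 + T g) : x y / (x * y)%g >-> x * y}}.
  move=> x y Gx Gy.
  have drM : dr (x * y)%g = dr x *m dr y + dr x + dr y.
    by rewrite /dr rhoM //; apply: mulB1.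
  rewrite mulrDl mul1r mulrDr mulr1 -addrA; congr (_ + _).
  have TxTy i j : (T x * T y) i j = e i *m (dr x *m dr y) *m e j.
    transitivity (e i *m dr x *m (\sum_(k < c.+1) e k) *m (dr y *m e j)).
      rewrite mulmx_sumr mulmx_suml mxE; apply: eq_bigr => k _.
      by rewrite !TE -[in RHS](ee k) // -mulmxE !mulmxA.
    rewrite sum_e qid ?mulmxA //.
    by apply: submx_trans (edr _ _ Gx _) (flag_sub V_S _) => //; apply: ltnW.
  apply/matrixP=> i j; rewrite TE drM 2!mulmxDr 2!mulmxDl -TxTy -!TE.
  have addE (A B : sqmx 'M[K]_d.+1 c) : (A + B) i j = A i j + B i j.
    by rewrite mxE.
  by rewrite !addE addrC [_ i j + T x i j]addrC.
clearbody T.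
have fM : {in G &, {morph (fun g => uni (T g)) : x y / (x * y)%g}}.
  by move=> x y Gx Gy; apply: uniM; rewrite ?lowT ?groupM //; apply: TM.
exists (Morphism fM); split; last first.
  by apply/subsetP=> _ /morphimP[x Gx _ ->]; apply: uni_in => //; apply: lowT.
apply/subsetP=> x Kx; have Gx := dom_ker Kx; apply/set1P/rho_faithful => //.
have T0 : T x = 0 by apply: uni_eq1 (lowT x Gx) (mker Kx).
rewrite -/(dr x).
have Vdr : (V c.+1 *m dr x <= V c.+1)%MS := submx_trans (rhoV c Gx) (V_S c).
rewrite -(qid _ _ _ (leqnn _) Vdr).
rewrite -[V _ in LHS](qid _ _ _ (leqnn _) (submx_refl _)).
rewrite -sum_e mulmx_sumr big1 // => j _.
rewrite mulmx_sumr 2!mulmx_suml big1 // => i _.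
by rewrite -!mulmxA [e i *m _]mulmxA -TE T0 mxE mulmx0.
Qed.
End FlagEmbedding.

(** * The flag of polynomial functions *)

Section TranslationModule.
Variables (K : finFieldType) (gT : finGroupType) (G : {group gT}).
Local Notation d := #|gT|.-1.

Lemma card_prednK : #|gT| = d.+1.
Proof. by rewrite prednK //; apply/card_gt0P; exists 1%g. Qed.

Definition elt_rank (x : gT) : 'I_d.+1 := cast_ord card_prednK (enum_rank x).
Definition rank_elt (i : 'I_d.+1) : gT :=
  enum_val (cast_ord (esym card_prednK) i).

Lemma elt_rankK : cancel elt_rank rank_elt.
Proof. by move=> x; rewrite /elt_rank /rank_elt cast_ordK enum_rankK. Qed.

Lemma rank_eltK : cancel rank_elt elt_rank.
Proof. by move=> x; rewrite /elt_rank /rank_elt enum_valK cast_ordKV. Qed.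

Definition row_fun (v : 'rV[K]_d.+1) (x : gT) : K := v 0 (elt_rank x).
Definition fun_row (f : gT -> K) : 'rV[K]_d.+1 := \row_i f (rank_elt i).

Lemma fun_rowK f : row_fun (fun_row f) =1 f.
Proof. by move=> x; rewrite /row_fun mxE elt_rankK. Qed.

(** The permutation matrix that acts on row vectors, seen as functions on gT,
    by f |-> f (g * _). *)
Definition translation (g : gT) : 'M[K]_d.+1 :=
  \matrix_(i, j) (i == elt_rank (g * rank_elt j)%g)%:R.

Lemma row_fun_translation v g x :
  row_fun (v *m translation g) x = row_fun v (g * x)%g.
Proof.
rewrite /row_fun mxE (bigD1 (elt_rank (g * x)%g)) //= big1 => [|i ne].
  by rewrite mxE elt_rankK eqxx mulr1 addr0.
by rewrite mxE elt_rankK (negPf ne) mulr0.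
Qed.

Lemma row_fun_inj u v : row_fun u =1 row_fun v -> u = v.
Proof.
by move=> e; apply/rowP=> i; have := e (rank_elt i); rewrite /row_fun rank_eltK.
Qed.

Lemma translationM g h : translation (g * h) = translation g *m translation h.
Proof.
apply/row_matrixP=> i; rewrite !rowE mulmxA; apply: row_fun_inj => x.
by rewrite !row_fun_translation mulgA.
Qed.

(** Polynomial functions are taken to vanish outside G, so that the bottom term
    of the flag is 0. *)
Definition deg_space k : 'M[K]_d.+1 :=
  (\sum_(v : 'rV[K]_d.+1 | pdeg G G k (row_fun v) &&
      [forall x, (x \notin G) ==> (row_fun v x == 0)]) <<v>>)%MS.

Lemma deg_spaceP k (u : 'rV[K]_d.+1) :
  reflect (pdeg G G k (row_fun u) /\ forall x, x \notin G -> row_fun u x = 0)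
          (u <= deg_space k)%MS.
Proof.
apply: (iffP idP) => [/sub_sumsmxP[w ->] | [Du u0]]; last first.
  have Pu : pdeg G G k (row_fun u) &&
      [forall x, (x \notin G) ==> (row_fun u x == 0)].
    by rewrite Du; apply/forallP=> x; apply/implyP=> /u0->.
  by apply: (sumsmx_sup u) => //; rewrite genmxE.
elim/big_ind: _ => [|u1 u2 [D1 Z1] [D2 Z2]|v /andP[Dv /forallP Zv]].
- by split=> [|x _]; [apply: pdeg_eq0 => x _|]; rewrite /row_fun mxE.
- split=> [|x nGx].
    by apply: eq_pdeg (pdegD D1 D2) => x _; rewrite /row_fun mxE.
  have := Z1 x nGx; have := Z2 x nGx.
  by rewrite /row_fun mxE => -> ->; rewrite addr0.
have /sub_rVP[a ->] : (w v *m <<v>> <= v)%MS.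
  by apply: submx_trans (submxMl _ _) _; rewrite genmxE.
split=> [|x nGx].
  have Z0 : pdeg G G k (fun _ => 0 : K) by apply: pdeg_eq0.
  by apply: eq_pdeg (pdeg_lin a Dv Z0) => x _; rewrite /row_fun mxE addr0.
have /implyP/(_ nGx)/eqP := Zv x.
by rewrite /row_fun mxE => ->; rewrite mulr0.
Qed.

Lemma deg_space0 : deg_space 0 = 0.
Proof.
apply/eqP; rewrite -submx0; apply/row_subP=> i; rewrite submx0.
have /deg_spaceP[/pdeg0P Z Z'] := row_sub i (deg_space 0).
apply/eqP/row_fun_inj => x; rewrite [RHS]mxE.
by have [/Z | /Z'] := boolP (x \in G).
Qed.

Lemma deg_spaceS k : (deg_space k <= deg_space k.+1)%MS.
Proof.
apply/row_subP=> i; have /deg_spaceP[D Z] := row_sub i (deg_space k).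
by apply/deg_spaceP; split=> //; apply: pdegW D.
Qed.

Lemma row_fun_dif (v : 'rV_d.+1) g x :
  row_fun (v *m (translation g - 1%:M)) x = dif g (row_fun v) x.
Proof.
rewrite /dif -row_fun_translation mulmxBr mulmx1.
by rewrite /row_fun [LHS]mxE [X in _ + X]mxE.
Qed.

Lemma deg_space_dif g k : g \in G ->
  (deg_space k.+1 *m (translation g - 1%:M) <= deg_space k)%MS.
Proof.
move=> Gg; apply/row_subP=> i; rewrite row_mul.
have /deg_spaceP[D Z] := row_sub i (deg_space k.+1).
apply/deg_spaceP; split=> [|x nGx]; last first.
  by rewrite row_fun_dif /dif !Z ?subrr ?groupMl.
apply: (@eq_pdeg _ _ _ _ _ (dif g (row_fun (row i (deg_space k.+1))))).
  by move=> x _; rewrite row_fun_dif.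
have := @pdeg_dif _ G _ G k.+1 _ 1 g isT Gg; rewrite lcn1 subn1 => dfD.
exact: dfD Gg D.
Qed.

(** An element that acts trivially on the top of the flag fixes all the
    functions of degree at most c, in particular their value at 1. *)
Lemma embed_of_separation c :
    (forall g, g \in G -> g != 1%g ->
       exists2 f : gT -> K, pdeg G G c.+1 f & f g != f 1%g) ->
  embeds_in G (uni_group 'M[K]_d.+1 c 1).
Proof.
move=> sepG; apply: (@flag_embedding _ _ _ _ _ deg_space translation).
- exact: deg_spaceS.
- exact: deg_space0.
- by move=> x y _ _; apply: translationM.
- by move=> g k; apply: deg_space_dif.
move=> g Gg Z; apply/eqP; apply: contraT => nt_g.
have [f Df /eqP[]] := sepG g Gg nt_g; pose f0 x := if x \in G then f x else 0.
have V0 : (fun_row f0 <= deg_space c.+1)%MS.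
  apply/deg_spaceP; split=> [|x nGx]; last by rewrite fun_rowK /f0 (negPf nGx).
  by apply: eq_pdeg Df => x Gx; rewrite fun_rowK /f0 Gx.
have [D eD] := submxP V0.
have : row_fun (fun_row f0 *m (translation g - 1%:M)) 1%g = 0.
  by rewrite eD -mulmxA Z mulmx0 /row_fun mxE.
by rewrite row_fun_dif /dif !fun_rowK /f0 mulg1 Gg group1 => /subr0_eq.
Qed.
End TranslationModule.

Local Close Scope ring_scope.
Local Close Scope group_scope.

Theorem mainTheorem2 (c p : nat) (hc : 1 <= c) (hp : prime p) (hcp : c < p)
    (gT : finGroupType) (G : {group gT})
    (hnil : c_nilpotent c G) (hexp : has_exponent p G) :
  exists (rT : finGroupType) (H : {group rT}),
    c_nilpotent c H /\ has_exponent p H /\ UL_equivalent c H /\ embeds_in G H.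
Proof.
have [nilG clG] := hnil.
have LG1 : ('L_c.+1(G) = 1)%g by apply/lcn_nil_classP.
have sGL : G \subset ('L_1(G))%g by rewrite lcn1.
pose K : finFieldType := 'F_p.
exists {unit sqmx 'M[K]_(#|gT|.-1.+1) c}.
exists (uni_group 'M[K]_(#|gT|.-1.+1) c 1).
split; first exact: uni_c_nilpotent.
split; first by apply: uni_exponent => //; rewrite pchar_lalg pchar_Fp.
split; first exact: uni_UL.
apply: embed_of_separation => g Gg nt_g.
exact: (separation hp hexp LG1 (isT : 0 < 1) sGL (lcn_sub 2 G) Gg nt_g).
Qed.
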